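(* For every $\mathcal I\in\mathcal{AN}$ there is $\mathcal J\in\mathcal{AN}$ such that $\mathcal I<_K\mathcal J$.
   Context: For a free filter $F$ on $\omega$, $N_F=\omega\cup\{p_F\}$ has points of $\omega$ isolated and neighbourhoods of $p_F$ of form $A\cup\{p_F\}$, $A\in F$. $F$ has the Nikodym property if there is no sequence of finitely supported measures $\mu_n=\sum_i\alpha_i\delta_{x_i}$ on $N_F$ with $\|\mu_n\|=\sum|\alpha_i|\to\infty$ and $\mu_n(A)\to0$ for all clopen $A\subseteq N_F$. $\mathcal{AN}$ is the class of ideals $\mathcal I$ on $\omega$ (duals of free filters) whose dual filter $\mathcal I^*$ lacks the Nikodym property. $\mathcal I\le_K\mathcal J$ if some $f\colon\omega\to\omega$ has $f^{-1}[A]\in\mathcal J$ for all $A\in\mathcal I$; $\mathcal I<_K\mathcal J$ means $\mathcal I\le_K\mathcal J$ and not $\mathcal J\le_K\mathcal I$. *)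

(* Defs.v *)
From HB Require Import structures.
From mathcomp Require Import all_boot all_order all_algebra.
From mathcomp Require Import all_classical all_reals all_analysis.
Set Implicit Arguments.
Unset Strict Implicit.
Unset Printing Implicit Defensive.
Import Order.TTheory GRing.Theory Num.Theory.
Import numFieldNormedType.Exports.
Local Open Scope classical_set_scope.
Local Open Scope ring_scope.

Record free_filter := FreeFilter {
  ff_sets :> set nat -> Prop;
  ff_proper : ProperFilter ff_sets;
  ff_free : \bigcap_(A in ff_sets) A = set0 }.

(* [None] is the point p_F; the carrier does not depend on F, but the topology
   attached to the alias [NF F] does. *)
Definition NF (F : free_filter) : Type := option nat.

Section NF_topology.
Variable F : free_filter.

HB.instance Definition _ := Choice.on (NF F).

Definition NF_nbhs (x : NF F) : set_system (NF F) :=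
  match x with
  | Some n => [set U | U (Some n)]
  | None => [set Some @` A `|` [set None] | A in ff_sets F]
  end.

Lemma NF_nbhs_pF (U : set (NF F)) :
  NF_nbhs None U <-> U None /\ F (Some @^-1` U).
Proof.
split=> [[A FA <-]|[U0 FU]].
- split; first by right.
  suff -> : Some @^-1` (Some @` A `|` [set None]) = A by [].
  apply/seteqP; split=> n /=; last by move=> An; left; exists n.
  by case=> [[m Am [<-]]|].
- exists (Some @^-1` U) => //; apply/seteqP; split=> [x|[n|] Ux] /=.
  + by case=> [[n Un <-]|->].
  + by left; exists n.
  + by right.
Qed.

HB.instance Definition _ := hasNbhs.Build (NF F) NF_nbhs.

Let NF_nbhs_filter (x : NF F) : ProperFilter (nbhs x).
Proof.
have PF := ff_proper F.
case: x => [n|]; split.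
- by move=> /= [].
- split=> [//|P Q Pn Qn|P Q PQ Pn]; first by split.
  exact: PQ.
- by move=> /NF_nbhs_pF[].
- split.
  + by apply/NF_nbhs_pF; split=> //; exact: filterT.
  + move=> P Q /NF_nbhs_pF[P0 FP] /NF_nbhs_pF[Q0 FQ].
    by apply/NF_nbhs_pF; split=> //; rewrite preimage_setI; exact: filterI.
  + move=> P Q PQ /NF_nbhs_pF[P0 FP]; apply/NF_nbhs_pF; split; first exact: PQ.
    by apply: filterS FP => n; exact: PQ.
Qed.

Let NF_nbhs_singleton (x : NF F) (A : set (NF F)) : nbhs x A -> A x.
Proof. by case: x => [n //|/NF_nbhs_pF[]]. Qed.

Let NF_nbhs_nbhs (x : NF F) (A : set (NF F)) :
  nbhs x A -> nbhs x (nbhs^~ A).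
Proof.
case: x => [n //|NA]; apply/NF_nbhs_pF; split=> //.
by move/NF_nbhs_pF: NA => [].
Qed.

HB.instance Definition _ := Nbhs_isNbhsTopological.Build (NF F)
  NF_nbhs_filter NF_nbhs_singleton NF_nbhs_nbhs.

End NF_topology.

Section measures.
Variables (R : realType) (F : free_filter).

(* A function [alpha : NF F -> R] with finite support encodes the measure
   \sum_x alpha(x) \delta_x, and \1_A x is \delta_x(A). *)
Definition finitely_supported (alpha : NF F -> R) : Prop :=
  finite_set [set x | alpha x != 0].

Definition fsmeasure (alpha : NF F -> R) (A : set (NF F)) : R :=
  \sum_(x \in [set: NF F]) alpha x * \1_A x.

Definition fsnorm (alpha : NF F -> R) : R :=
  \sum_(x \in [set: NF F]) `|alpha x|.

Definition nikodym_property : Prop :=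
  ~ exists mu : nat -> NF F -> R,
      [/\ forall n, finitely_supported (mu n),
          fsnorm (mu n) @[n --> \oo] --> +oo
        & forall A : set (NF F), clopen A ->
            fsmeasure (mu n) A @[n --> \oo] --> (0 : R)].

End measures.

Record ideal := Ideal {
  ideal_sets :> set nat -> Prop;
  ideal_finite : forall A : set nat, finite_set A -> ideal_sets A;
  ideal_setU : forall A B : set nat,
    ideal_sets A -> ideal_sets B -> ideal_sets (A `|` B);
  ideal_subset : forall A B : set nat,
    A `<=` B -> ideal_sets B -> ideal_sets A;
  ideal_proper : ~ ideal_sets setT }.

Section dual_filter.
Variable I : ideal.

Definition dual_sets : set_system nat := [set A | I (~` A)].

Lemma dual_sets_proper : ProperFilter dual_sets.
Proof.
split; first by rewrite /dual_sets /= setC0; exact: (@ideal_proper I).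
split; rewrite /dual_sets /=.
- by rewrite setCT; apply: ideal_finite; exact: finite_set0.
- by move=> A B IA IB /=; rewrite setCI; exact: ideal_setU.
- by move=> A B AB; apply: ideal_subset; exact: subsetC.
Qed.

Lemma dual_sets_free : \bigcap_(A in dual_sets) A = set0.
Proof.
apply/seteqP; split=> // n /(_ (~` [set n])); apply => //.
by rewrite /dual_sets /= setCK; exact/ideal_finite/finite_set1.
Qed.

Definition dual_filter : free_filter :=
  FreeFilter dual_sets_proper dual_sets_free.

End dual_filter.

Definition AN (R : realType) : set ideal :=
  [set I | ~ nikodym_property R (dual_filter I)].

Definition katetov_le (I J : ideal) : Prop :=
  exists f : nat -> nat, forall A : set nat, I A -> J (f @^-1` A).

Definition katetov_lt (I J : ideal) : Prop :=
  katetov_le I J /\ ~ katetov_le J I.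

(* Main.v *)
Require Import Defs.
From mathcomp Require Import all_boot all_order all_algebra.
From mathcomp Require Import all_classical all_reals all_analysis.
From mathcomp Require Import zify ring lra.

(** An ideal I is in AN iff some finitely supported measures nu_n on omega have
    ||nu_n|| -> oo and nu_n(A) -> 0 for all A in I: the weight of p_F only
    serves to cancel the total mass.  By Schur's theorem the nu_n may be replaced
    by rho_n = |nu_n|, and after thinning out ||rho_n|| > (n + 1)^2.

    Let lam_m live on {m} x omega x L_m and be rho_m scaled down to mass m + 1,
    times the uniform probability on L_m, where #|L_m| is huge compared with
    the supports of rho_n for n < m.  Then J = {A | lam_m(A) -> 0} is in AN, and
    projecting to the middle coordinate gives I <=_K J.  Conversely, let F map
    omega to the triples.  For m > n the set F(supp rho_n) is lam_m-small because
    it is so much smaller than L_m.  For m <= n, cutting L_m into (n + 1)^2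
    residue classes gives pieces of lam_m-mass about (m + 1) / (n + 1)^2, while
    the preimages of some class together with F(supp rho_n) above level n have
    rho_n-mass at least 1.  Gluing such test sets for sparse n by a gliding hump
    gives a set of J whose preimage is not in I. *)

Section proof.
Import Order.TTheory GRing.Theory Num.Theory numFieldNormedType.Exports.
Local Open Scope classical_set_scope.
Local Open Scope ring_scope.

(** * Gluing sets along consecutive blocks *)

(** Iterating the choice of [M] from 0 cuts the levels [c t] into consecutive blocks, and each level
    lies in at most one block, so the chosen sets glue. Used with [c = id] for Schur's theorem and
    with [c = fst] against the reverse reduction. *)
Lemma gliding_hump {T : Type} (c : T -> nat) (P : nat -> nat -> set T -> Prop) :
  (forall N, exists M A, (N < M)%N /\ P N M A) ->
  exists (U : set T) (a : nat -> nat),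
    [/\ a 0 = 0, forall i, (a i < a i.+1)%N
      & forall i, exists A, P (a i) (a i.+1) A /\
          forall t, (a i <= c t < a i.+1)%N -> (U t <-> A t)].
Proof.
move=> /choice[M] /choice[A MA].
pose a i := iter i M 0.
have aS i : (a i < a i.+1)%N by have [] := MA (a i).
have amono : {homo a : i j / (i < j)%N}.
  by apply: homo_ltn => //; exact: ltn_trans.
exists [set t | exists i, (a i <= c t < a i.+1)%N /\ A (a i) t], a; split=> // i.
exists (A (a i)); split; first by have [] := MA (a i).
move=> t ti; split=> [[j [tj Aj]]|At]; last by exists i.
suff -> : i = j by [].
case: (ltngtP i j) => // ij; exfalso.
  have : (a i.+1 <= a j)%N.
    by move: ij; rewrite leq_eqVlt => /orP[/eqP->//|/amono/ltnW].
  by lia.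
have : (a j.+1 <= a i)%N.
  by move: ij; rewrite leq_eqVlt => /orP[/eqP->//|/amono/ltnW].
by lia.
Qed.

Lemma increasing_ge_id (a : nat -> nat) :
  (forall i, a i < a i.+1)%N -> forall i, (i <= a i)%N.
Proof. by move=> aS; elim=> // i IH; exact: leq_ltn_trans IH (aS i). Qed.

Lemma increasing_block (a : nat -> nat) : a 0 = 0 ->
  (forall i, a i < a i.+1)%N -> forall m, exists i, (a i <= m < a i.+1)%N.
Proof.
move=> a0 aS; elim=> [|m [i im]].
  by exists 0; have := aS 0; lia.
case: (ltnP m.+1 (a i.+1)) => mi; first by exists i; lia.
by exists i.+1; have := aS i.+1; lia.
Qed.

Context {R : realType}.

(** * Schur's theorem for finitely supported sequences *)

Lemma cvgn0P (u : nat -> R) : u n @[n --> \oo] --> (0 : R) <->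
  forall e : R, 0 < e -> exists N, forall n, (N <= n)%N -> `|u n| < e.
Proof.
split=> [/cvgr0Pnorm_lt ue e /ue[N _ uN]|ue].
  by exists N => n; exact: uN.
by apply/cvgr0Pnorm_lt => e /ue[N uN]; exists N.
Qed.

(** The nonnegative or the negative terms carry at least half of the mass. Being a predicate on
    values and not on indices, [Q] also cuts out a subset of [nat]. *)
Lemma half_of_sum_norm {I : finType} (P : pred I) (f : I -> R) :
  exists Q : pred R,
    \sum_(i | P i) `|f i| <= 2 * `|\sum_(i | P i && Q (f i)) f i|.
Proof.
have -> : \sum_(i | P i) `|f i| =
    `|\sum_(i | P i && (0 <= f i)) f i| + `|\sum_(i | P i && (f i < 0)) f i|.
  rewrite (bigID (fun i => 0 <= f i)) /=; congr (_ + _).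
    rewrite ger0_norm; last by apply: sumr_ge0 => i /andP[].
    by apply: eq_bigr => i /andP[_ /ger0_norm].
  rewrite ler0_norm; last by apply: sumr_le0 => i /andP[_ /ltW].
  rewrite -sumrN; apply: eq_big => i; first by rewrite -ltNge.
  by rewrite -ltNge => /andP[_ /ltr0_norm].
set p := `|_|; set q := `|_|.
have [pq|/ltW pq] := leP q p.
  by exists (fun x => 0 <= x); rewrite -/p mulr_natl mulr2n lerD2l.
by exists (fun x => x < 0); rewrite -/q mulr_natl mulr2n lerD2r.
Qed.

(** Singletons inside [B] are test sets, so each coordinate in [B] tends to 0, and the head has at
    most [N] of them. *)
Lemma cvg0_norm_head (nu : nat -> nat -> R) (b : nat -> nat) (B : set nat) :
  (forall B', B' `<=` B ->
    (\sum_(x < b n | (x : nat) \in B') nu n x) @[n --> \oo] --> (0 : R)) ->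
  forall N, (\sum_(x < b n | ((x : nat) \in B) && (x < N)%N) `|nu n x|)
    @[n --> \oo] --> (0 : R).
Proof.
move=> nuB; elim=> [|N IH].
  rewrite [X in X @ _ --> _](_ : _ = cst 0); first exact: cvg_cst.
  by apply/funext => n; rewrite big1 // => x; rewrite ltn0 andbF.
have [BN|BN] := boolP (N \in B); last first.
  apply: cvg_trans IH; apply: near_eq_cvg; near=> n.
  apply: eq_bigl => x; rewrite (ltnS x N) (leq_eqVlt x N).
  by case: eqP => //= ->; rewrite (negbTE BN).
have N1 : (`|\sum_(x < b n | (x : nat) \in [set N]) nu n x| : R)
    @[n --> \oo] --> (0 : R).
  have NB : [set N] `<=` B by move=> x ->; rewrite -in_setE.
  apply/cvgn0P => e /(proj1 (cvgn0P _) (nuB _ NB))[K NK].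
  by exists K => n /NK; rewrite normr_id.
suff E n : \sum_(x < b n | ((x : nat) \in B) && (x < N.+1)%N) `|nu n x| =
    \sum_(x < b n | ((x : nat) \in B) && (x < N)%N) `|nu n x| +
    `|\sum_(x < b n | (x : nat) \in [set N]) nu n x|.
  rewrite (funext E) -[X in _ --> X](addr0 0); exact: cvgD IH N1.
rewrite [LHS](bigID (fun x : 'I__ => (x < N)%N)) /=; congr (_ + _).
  by apply: eq_bigl => x; case: (_ \in B) => //=; lia.
have [bN|bN] := ltnP N (b n); last first.
  rewrite !big_pred0 ?normr0// => x; have xb := ltn_ord x.
    by apply/negbTE/negP; rewrite in_setE /= => xN; lia.
  by case: (_ \in B) => //=; lia.
rewrite !(big_pred1 (Ordinal bN)) // => x; last first.
  rewrite /= -val_eqE /=; apply/idP/eqP => [|->]; last by rewrite BN; lia.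
  by case: (_ \in B) => //=; lia.
by rewrite /= -val_eqE /=; apply/idP/eqP; rewrite in_setE.
Unshelve. all: by end_near.
Qed.

(** Otherwise mass [e] recurs while every head dies out, so mass recurs in disjoint blocks; keeping
    one sign in each block yields a subset of [B] whose measures do not tend to 0. *)
Lemma schur_l1 (nu : nat -> nat -> R) (b : nat -> nat) (B : set nat) :
  (forall B', B' `<=` B ->
    (\sum_(x < b n | (x : nat) \in B') nu n x) @[n --> \oo] --> (0 : R)) ->
  (\sum_(x < b n | (x : nat) \in B) `|nu n x|) @[n --> \oo] --> (0 : R).
Proof.
move=> nuB; apply/cvgn0P => e e0; apply: contrapT => noN.
have bigB N : exists2 n, (N <= n)%N &
    e <= \sum_(x < b n | (x : nat) \in B) `|nu n x|.
  apply: contrapT => H; apply: noN; exists N => n Nn.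
  rewrite ger0_norm ?sumr_ge0// ltNge; apply/negP => en.
  by apply: H; exists n.
(* A head below [e / 4] leaves more than [3 * e / 4] in the tail, hence more than [3 * e / 8] in one
   sign; subtracting the head on [U] still leaves more than [e / 8]. *)
have [N|U [a [a0 aS aU]]] := @gliding_hump _ id
  (fun N M A => exists n, [/\ (N <= n)%N, (b n <= M)%N,
     \sum_(x < b n | ((x : nat) \in B) && (x < N)%N) `|nu n x| < e / 4
   & 3 * e / 8 < `|\sum_(x < b n | [&& (x : nat) \in B, (N <= x)%N
                                  & (x : nat) \in A]) nu n x|]).
  have /cvgn0P/(_ (e / 4)) [|N' headN'] := cvg0_norm_head _ _ _ nuB N.
    by rewrite divr_gt0.
  have [n] := bigB (maxn N N'); rewrite geq_max => /andP[Nn N'n] en.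
  have [Q] := half_of_sum_norm
    (fun x : 'I_(b n) => ((x : nat) \in B) && (N <= x)%N) (fun x => nu n x).
  set s := \sum_(_ < _ | _) _; set t := \sum_(_ < _ | _) _ => st.
  exists (maxn N.+1 (b n)), [set x | Q (nu n x)].
  split; first by rewrite leq_max ltnSn.
  exists n; split=> //.
  - by rewrite leq_maxr.
  - by rewrite (le_lt_trans (ler_norm _)) ?headN'.
  - have -> : \sum_(x < b n | [&& (x : nat) \in B, (N <= x)%N
        & (x : nat) \in [set x0 | Q (nu n x0)]]) nu n x = t.
      by apply: eq_bigl => x; rewrite andbA; congr (_ && _); rewrite mem_setE.
    have : e < e / 4 + s.
      apply: le_lt_trans en _.
      rewrite (bigID (fun x : 'I__ => (x < N)%N)) /=.
      rewrite [X in _ + X](eq_bigl (fun x : 'I__ => ((x : nat) \in B) && (N <= x)%N)).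
        rewrite ltrD2r (le_lt_trans (ler_norm _)) ?headN'//.
      by move=> x; rewrite -leqNgt.
    by move: e0 st => /= ? ? ?; lra.
have /nuB/cvgn0P/(_ (e / 8)) [|K UK] : U `&` B `<=` B by move=> x [].
  by rewrite divr_gt0.
have [A [[n [an bn head tail]] UA]] := aU K.
have /UK : (K <= n)%N by apply: leq_trans an; exact: increasing_ge_id.
rewrite (bigID (fun x : 'I__ => (x < a K)%N)) /=.
rewrite [X in _ + X](eq_bigl (fun x : 'I__ => [&& (x : nat) \in B,
   (a K <= x)%N & (x : nat) \in A])); last first.
  move=> x; rewrite in_setI -leqNgt; case: (leqP (a K) x) => ax;
    rewrite ?andbF// andbT andbC /=; congr (_ && _).
  apply/idP/idP; rewrite !in_setE => /UA; apply;
    by rewrite ax (leq_trans (ltn_ord x) bn).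
set h := \sum_(_ < _ | _) _ => /=; set t := \sum_(_ < _ | _) _ => ht.
have : `|h| < e / 4.
  apply: le_lt_trans head; rewrite /h (le_trans (ler_norm_sum _ _ _)) //.
  rewrite [leLHS]big_mkcond [leRHS]big_mkcond /=; apply: ler_sum => x _.
  by rewrite in_setI; case: (_ \in U); case: (_ \in B); case: (x < a K)%N => /=.
move: tail; rewrite -/t => tail hh.
have : `|t| <= `|h + t| + `|h|.
  by have := ler_normB (h + t) h; rewrite [h + t]addrC addrK.
by lra.
Qed.

(** * Membership in AN through weights on omega *)

Lemma cvgnyP (u : nat -> R) : u n @[n --> \oo] --> +oo <->
  forall M : R, exists N, forall n, (N <= n)%N -> M <= u n.
Proof.
split=> [/cvgryPge uy M|uy].
  by have [N _ uN] := uy M; exists N => n; exact: uN.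
by apply/cvgryPge => M; have [N uN] := uy M; exists N.
Qed.

Lemma fsbig_option (F : free_filter) (n : nat) (f : NF F -> R) :
  (forall x, (n <= x)%N -> f (Some x) = 0) ->
  \sum_(x \in [set: NF F]) f x = f None + \sum_(x < n) f (Some (x : nat)).
Proof.
move=> f0; rewrite (fsbigE (None :: [seq Some x | x <- iota 0 n])) //.
- rewrite big_cons in_setT big_map -[n in iota 0 n]subn0 big_mkord.
  by congr (_ + _); apply: eq_bigl => x; rewrite in_setT.
- rewrite /= map_inj_uniq ?iota_uniq ?andbT; last by move=> x y [].
  by apply/negP => /mapP[].
- case=> [x|] _; last by rewrite inE eqxx.
  rewrite inE /= (mem_map Some_inj).
  by rewrite mem_iota /= add0n -leqNgt => /f0.
Qed.

Lemma clopen_image_Some (J : ideal) (A : set nat) :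
  J A -> clopen (Some @` A : set (NF (dual_filter J))).
Proof.
move=> JA; split; last first.
  rewrite -openC openE => -[x|] Ax; first exact: Ax.
  apply/NF_nbhs_pF; split; first exact: Ax.
  apply: ideal_subset JA => x /= /contrapT[y Ay [<-]] //.
by rewrite openE => _ [x Ax <-]; exists x.
Qed.

(** Whichever of [A] and its complement contains p_F is a neighbourhood of p_F, so its trace on
    omega lies in the dual filter. *)
Lemma clopen_ideal (J : ideal) (A : set (NF (dual_filter J))) :
  clopen A -> J (Some @^-1` A) /\ ~ A None \/ J (~` (Some @^-1` A)) /\ A None.
Proof.
case=> oA; rewrite -openC => oCA; have [An|nAn] := pselect (A None).
  right; split=> //; move: oA; rewrite openE => /(_ _ An) /NF_nbhs_pF[_].
  exact.
left; split=> //; move: oCA; rewrite openE => /(_ _ nAn) /NF_nbhs_pF[_].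
by rewrite /= /dual_sets /= preimage_setC setCK.
Qed.

(** Push the weights forward along [pt] and put minus their total at p_F. The atom at p_F alone
    makes the norm large, and a clopen set containing p_F gets minus the weight of its complement,
    whose trace lies in the ideal. *)
Lemma AN_of_weights (J : ideal) (X : nat -> finType)
    (pt : forall m, X m -> nat) (w : forall m, X m -> R) :
  (\sum_(i : X m) w m i) @[m --> \oo] --> +oo ->
  (forall A, J A ->
     (\sum_(i : X m | pt m i \in A) w m i) @[m --> \oo] --> (0 : R)) ->
  AN R J.
Proof.
move=> wy w0; rewrite /AN /= /nikodym_property not_notE.
pose alpha m (x : NF (dual_filter J)) : R :=
  if x is Some y then \sum_(i : X m | pt m i == y) w m i
  else - \sum_(i : X m) w m i.
pose B m := (\max_(i : X m) pt m i).+1.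
have alpha0 m x : (B m <= x)%N -> alpha m (Some x) = 0.
  move=> Bx; rewrite /alpha big_pred0 // => i; apply/negbTE/negP => /eqP ix.
  by have := @leq_bigmax (X m) (pt m) i; rewrite /B in Bx; rewrite ix; lia.
have muE m A : fsmeasure (alpha m) A =
    - (\sum_(i : X m) w m i) * \1_A None +
    \sum_(i : X m | pt m i \in Some @^-1` A) w m i.
  rewrite /fsmeasure (@fsbig_option _ (B m)); last first.
    by move=> x /alpha0->; rewrite mul0r.
  congr (_ + _) => /=.
  under eq_bigr do rewrite /alpha big_distrl /= big_mkcond.
  rewrite exchange_big /= [RHS]big_mkcond /=; apply: eq_bigr => i _.
  have iB : (pt m i < B m)%N by rewrite ltnS leq_bigmax.
  rewrite (bigD1 (Ordinal iB)) //= eqxx big1 ?addr0.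
    rewrite indicE (_ : (pt m i \in Some @^-1` A) = (Some (pt m i) \in A)) //.
    by case: (_ \in A); rewrite ?mulr1 ?mulr0.
  by move=> x /negP; rewrite -val_eqE /= eq_sym => /negP/negbTE->.
exists alpha; split.
- move=> m; apply: (@sub_finite_set _ _ ([set None] `|` Some @` `I_(B m))).
    case=> [x|] /= x0; [right|by left].
    exists x => //=; rewrite ltnNge.
    by apply/negP => Bx; move/eqP: x0; apply; exact: (alpha0 m).
  by rewrite finite_setU; split; [exact: finite_set1|exact/finite_image/finite_II].
- apply/cvgnyP => M; have [N wN] := proj1 (cvgnyP _) wy M; exists N => n /wN Mw.
  rewrite /fsnorm (@fsbig_option _ (B n)); last first.
    by move=> x /alpha0->; rewrite normr0.
  apply: (le_trans Mw); rewrite /= normrN (le_trans (ler_norm _)) // lerDl.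
  exact: sumr_ge0.
- move=> A /clopen_ideal[[/w0 JA nA]|[/w0 JA nA]].
    rewrite [X in X @ _ --> _](_ : _ = fun m =>
      \sum_(i : X m | pt m i \in Some @^-1` A) w m i) //.
    by apply/funext => m; rewrite muE indicE memNset // mulr0 add0r.
  rewrite [X in X @ _ --> _](_ : _ = fun m =>
      - \sum_(i : X m | pt m i \in ~` (Some @^-1` A)) w m i).
    by rewrite -[X in _ --> X]oppr0; exact: cvgN JA.
  apply/funext => m; rewrite muE indicE mem_set // mulr1.
  rewrite (bigID (fun i => pt m i \in Some @^-1` A)) /= opprD addrAC addNr add0r.
  by congr (- _); apply: eq_bigl => i; rewrite in_setC.
Qed.

Lemma AN_weights (I : ideal) : AN R I -> exists (nu : nat -> nat -> R) (b : nat -> nat),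
  (\sum_(x < b n) `|nu n x|) @[n --> \oo] --> +oo /\
  forall A, I A ->
    (\sum_(x < b n | (x : nat) \in A) nu n x) @[n --> \oo] --> (0 : R).
Proof.
move=> /contrapT[mu [fs muy mu0]].
have [b mub] : exists b, forall n x, (b n <= x)%N -> mu n (Some x) = 0.
  suff /choice[b bP] : forall n, exists k, forall x, (k <= x)%N -> mu n (Some x) = 0.
    by exists b.
  move=> n; have /finite_seqP[s sE] := fs n.
  exists (\max_(y <- s) odflt 0 y).+1 => x sx; apply/eqP; apply: contraTT sx => x0.
  have : [set x | mu n x != 0] (Some x) by [].
  rewrite sE /= -ltnNge ltnS => xs.
  exact: (@leq_bigmax_seq _ s predT (odflt 0) (Some x) xs isT).
exists (fun n x => mu n (Some x)), b; split; last first.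
  move=> A IA; have := mu0 _ (clopen_image_Some _ _ IA).
  rewrite [X in X @ _ --> _](_ : _ = fun n =>
    \sum_(x < b n | (x : nat) \in A) mu n (Some (x : nat))) //.
  apply/funext => n; rewrite /fsmeasure (@fsbig_option _ (b n)); last first.
    by move=> x /mub->; rewrite mul0r.
  rewrite indicE memNset ?mulr0 ?add0r; last by case.
  rewrite [RHS]big_mkcond /=; apply: eq_bigr => x _.
  rewrite indicE (_ : (Some (x : nat) \in _) = ((x : nat) \in A)).
    by case: (_ \in A); rewrite ?mulr1 ?mulr0.
  apply/idP/idP; rewrite !in_setE; first by case=> y Ay [<-].
  by move=> Ax; exists x.
have /mu0/cvgn0P/(_ 1 ltr01)[N1 totN] : clopen [set: NF (dual_filter I)].
  by split; [exact: openT|exact: closedT].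
(* Testing the whole space bounds the atom at p_F by 1 plus the mass on omega, so a norm of
   [2 * M + 1] leaves at least [M] on omega. *)
apply/cvgnyP => M; have [N2 muN] := proj1 (cvgnyP _) muy (2 * M + 1).
exists (maxn N1 N2) => n; rewrite geq_max => /andP[/totN + /muN].
rewrite /fsmeasure /fsnorm !(@fsbig_option _ (b n)); last first.
- by move=> x /mub->; rewrite mul0r.
- by move=> x /mub->; rewrite normr0.
rewrite indicE in_setT mulr1.
under eq_bigr do rewrite indicE in_setT mulr1.
set t := \sum_(_ < _) _; set s := \sum_(_ < _) _ => mt ms.
have ts : `|t| <= s by exact: ler_norm_sum.
have : `|mu n None| <= `|mu n None + t| + `|t|.
  by have := ler_normB (mu n None + t) t; rewrite addrK.
by lra.
Qed.

(** * Counting in finite initial segments *)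

(** Within a residue class, [l] is determined by [l %/ p]. *)
Lemma card_ord_modn (L p j : nat) : (0 < p)%N ->
  (#|[pred l : 'I_L | l %% p == j]| <= (L %/ p).+1)%N.
Proof.
move=> p0; rewrite -[leqRHS]card_ord.
apply: (@leq_card_in _ _ (fun l : 'I_L => inord (l %/ p) : 'I_(L %/ p).+1)).
move=> l l'; rewrite !inE => /eqP lj /eqP l'j /(congr1 val) /=.
rewrite !inordK ?ltnS ?leq_div2r 1?ltnW// => ll'; apply/val_inj => /=.
by rewrite (divn_eq l p) (divn_eq l' p) ll' lj l'j.
Qed.

Lemma card_ord_image (L k : nat) (P : pred 'I_L) (g : nat -> nat) :
  (forall l, P l -> exists2 y, (y < k)%N & g y = l) -> (#|P| <= k)%N.
Proof.
move=> Pg; rewrite -[k](size_iota 0) -(size_map g) cardE -(size_map val).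
apply: uniq_leq_size; first by rewrite (map_inj_uniq val_inj) enum_uniq.
move=> _ /mapP[l /[!mem_enum] /Pg[y yk gy] ->]; apply/mapP; exists y => //.
by rewrite mem_iota.
Qed.

Lemma bounded_image (A : set nat) (g : nat -> nat) : finite_set A ->
  exists N, forall x, A x -> (g x < N)%N.
Proof.
move=> /finite_seqP[s ->]; exists (\max_(y <- s) g y).+1 => x /= xs.
by rewrite ltnS (@leq_bigmax_seq _ s predT g x xs).
Qed.

(** * The diffuse measures and their ideal *)

Section diffuse.
Variables (rho : nat -> nat -> R) (b : nat -> nat).
Hypothesis rho_ge0 : forall n x, 0 <= rho n x.
Let h n := \sum_(x < b n) rho n x.
Hypothesis h_large : forall n, ((n.+1 ^ 2).+1)%:R <= h n.

Let T : Type := (nat * (nat * nat))%type.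

(** The sum makes any [b n] points with n < m at most a fraction 1 / (m + 1)^2 of a fibre; the
    factor [m.+1 ^ 2] also absorbs the rounding when a fibre is cut into residue classes. *)
Definition fiber_size m := (m.+1 ^ 2 * (\sum_(n < m) b n).+1)%N.

Definition diffuse_weight m x : R :=
  rho m x * m.+1%:R / (h m * (fiber_size m)%:R).

(* The measure rho_m scaled to total mass m + 1, with each atom x spread evenly
   over the fibre {(m, (x, l)) | l < fiber_size m}. *)
Definition diffuse m (A : set T) : R :=
  \sum_(x < b m) \sum_(l < fiber_size m | (m, (x : nat, l : nat)) \in A)
     diffuse_weight m x.

Lemma total_mass_gt0 n : 0 < h n.
Proof. by apply: lt_le_trans (h_large n); rewrite ltr0n. Qed.

Lemma fiber_size_gt0 m : (0 < fiber_size m)%N.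
Proof. by rewrite muln_gt0 expn_gt0. Qed.

Lemma diffuse_weight_ge0 m x : 0 <= diffuse_weight m x.
Proof. by rewrite divr_ge0 ?mulr_ge0// ltW// total_mass_gt0. Qed.

Lemma sum_diffuse_weight m :
  \sum_(x < b m) diffuse_weight m x = m.+1%:R / (fiber_size m)%:R.
Proof.
rewrite -big_distrl -big_distrl /= -/(h m).
have := total_mass_gt0 m; have : 0 < (fiber_size m)%:R :> R by rewrite ltr0n fiber_size_gt0.
by move: (h m) (_%:R) => u v u0 v0; field; rewrite !gt_eqF.
Qed.

Lemma diffuse_ge0 m A : 0 <= diffuse m A.
Proof.
by apply: sumr_ge0 => x _; apply: sumr_ge0 => l _; exact: diffuse_weight_ge0.
Qed.

Lemma eq_diffuse m (A B : set T) :
  (forall t, t.1 = m -> (A t <-> B t)) -> diffuse m A = diffuse m B.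
Proof.
move=> AB; apply: eq_bigr => x _; apply: eq_bigl => l.
by apply/idP/idP; rewrite !in_setE => /AB; exact.
Qed.

Lemma le_diffuse m (A B : set T) : A `<=` B -> diffuse m A <= diffuse m B.
Proof.
move=> AB; apply: ler_sum => x _; rewrite [leLHS]big_mkcond [leRHS]big_mkcond /=.
apply: ler_sum => l _; case: ifPn => [/set_mem/AB/mem_set->//|_].
by case: ifP; rewrite ?diffuse_weight_ge0.
Qed.

Lemma diffuseU m (A B : set T) : diffuse m (A `|` B) <= diffuse m A + diffuse m B.
Proof.
rewrite -big_split; apply: ler_sum => x _ /=.
rewrite !(big_mkcond (fun l => _ \in _)) -big_split; apply: ler_sum => l _ /=.
rewrite in_setU; have := diffuse_weight_ge0 m x.
by case: (_ \in A); case: (_ \in B) => /=; lra.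
Qed.

Lemma diffuseT m : diffuse m setT = m.+1%:R.
Proof.
have L0 := fiber_size_gt0 m.
rewrite /diffuse; under eq_bigr do under eq_bigl do rewrite in_setT.
under eq_bigr do rewrite sumr_const card_ord -mulr_natr.
by rewrite -big_distrl /= sum_diffuse_weight divfK // pnatr_eq0 -lt0n.
Qed.

(** Mass is uniform on each fibre, so the set gets at most the share k / [fiber_size m] <= 2 / (m +
    1)^2 of the total m + 1. *)
Lemma diffuse_le m (A : set T) k :
  (forall x, #|[pred l : 'I_(fiber_size m) | (m, (x, l : nat)) \in A]| <= k)%N ->
  (k * m.+1 ^ 2 <= 2 * fiber_size m)%N ->
  diffuse m A <= 2 / m.+1%:R.
Proof.
move=> Ak kL; apply: (@le_trans _ _ (m.+1%:R / (fiber_size m)%:R * k%:R)).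
  rewrite -sum_diffuse_weight big_distrl /=; apply: ler_sum => x _.
  rewrite sumr_const -[leLHS]mulr_natr ler_wpM2l ?diffuse_weight_ge0//.
  by rewrite ler_nat; exact: Ak.
have L0 : 0 < (fiber_size m)%:R :> R by rewrite ltr0n fiber_size_gt0.
rewrite ler_pdivlMr ?ltr0n//.
rewrite (_ : _ * _%:R * _%:R = (k * m.+1 ^ 2)%:R / (fiber_size m)%:R).
  by rewrite ler_pdivrMr// -natrM ler_nat.
by rewrite natrM natrX; ring.
Qed.

Definition diffuse_sets : set (set T) :=
  [set A | diffuse m A @[m --> \oo] --> (0 : R)].

Lemma diffuse_sets_sub A B : A `<=` B -> diffuse_sets B -> diffuse_sets A.
Proof.
move=> AB /cvgn0P B0; apply/cvgn0P => e /B0[N BN]; exists N => m /BN.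
rewrite !ger0_norm ?diffuse_ge0//; apply: le_lt_trans; exact: le_diffuse.
Qed.

Lemma diffuse_sets_bounded N : diffuse_sets [set t | (t.1 < N)%N].
Proof.
apply/cvgn0P => e e0; exists N => m Nm; rewrite /diffuse big1 ?normr0// => x _.
by rewrite big_pred0// => l; apply/negbTE/negP; rewrite in_setE /=; lia.
Qed.

(** Numbers that code no triple get a default value; the ideal, pulled back along [pickle], does not
    see them. *)
Definition decode (y : nat) : T := odflt (0, (0, 0))%N (unpickle y).

Lemma pickleD (t : T) : decode (pickle t) = t.
Proof. by rewrite /decode pickleK. Qed.

Fact diffuse_ideal_finite (A : set nat) :
  finite_set A -> diffuse_sets (@pickle T @^-1` A).
Proof.
move=> /(@bounded_image _ (fst \o decode))[N AN].
apply: diffuse_sets_sub (diffuse_sets_bounded N) => t /= /AN /=.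
by rewrite pickleD.
Qed.

Fact diffuse_ideal_setU (A B : set nat) :
  diffuse_sets (@pickle T @^-1` A) -> diffuse_sets (@pickle T @^-1` B) ->
  diffuse_sets (@pickle T @^-1` (A `|` B)).
Proof.
rewrite preimage_setU => /cvgn0P A0 /cvgn0P B0; apply/cvgn0P => e e0.
have e2 : 0 < e / 2 by lra.
have [N AN] := A0 _ e2; have [M BM] := B0 _ e2.
exists (maxn N M) => m; rewrite geq_max => /andP[/AN + /BM].
rewrite !ger0_norm ?diffuse_ge0// => ? ?.
by apply: le_lt_trans (diffuseU _ _ _) _; lra.
Qed.

Fact diffuse_ideal_subset (A B : set nat) : A `<=` B ->
  diffuse_sets (@pickle T @^-1` B) -> diffuse_sets (@pickle T @^-1` A).
Proof. by move=> AB; apply: diffuse_sets_sub => t /AB. Qed.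

Fact diffuse_ideal_proper : ~ diffuse_sets (@pickle T @^-1` setT).
Proof.
rewrite preimage_setT => /cvgn0P/(_ 1 ltr01)[N /(_ N (leqnn N))].
by rewrite diffuseT ger0_norm// ltrn1.
Qed.

Definition diffuse_ideal : ideal := @Ideal
  [set A | diffuse_sets (@pickle T @^-1` A)]
  diffuse_ideal_finite diffuse_ideal_setU diffuse_ideal_subset
  diffuse_ideal_proper.

Lemma diffuse_pair m (A : set T) :
  diffuse m A = \sum_(i : 'I_(b m) * 'I_(fiber_size m) |
    (m, (i.1 : nat, i.2 : nat)) \in A) diffuse_weight m i.1.
Proof.
by rewrite /diffuse pair_big_dep.
Qed.

Lemma diffuse_ideal_AN : AN R diffuse_ideal.
Proof.
apply: (@AN_of_weights diffuse_ideal
  (fun m => ('I_(b m) * 'I_(fiber_size m))%type : finType)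
  (fun m i => pickle (m, (i.1 : nat, i.2 : nat)))
  (fun m i => diffuse_weight m i.1)) => [|A JA].
  apply/cvgnyP => M; exists (Num.trunc M) => n Mn.
  have -> : \sum_(i : 'I_(b n) * 'I_(fiber_size n)) diffuse_weight n i.1 = n.+1%:R.
    by rewrite -diffuseT diffuse_pair; apply: eq_bigl => i; rewrite in_setT.
  rewrite (le_trans (ltW (truncnS_gt M)))// ler_nat; exact: Mn.
by under eq_fun do rewrite -(diffuse_pair _ (@pickle T @^-1` A)).
Qed.

(** * Comparison in the Katetov order *)

(** The preimage of [A] under the middle projection fills or misses each fibre, so its mass is that
    of [rho m] on [A] times [m.+1 / h m], a factor at most 1. *)
Lemma le_diffuse_ideal (I : ideal) :
  (forall A, I A ->
    (\sum_(x < b n | (x : nat) \in A) rho n x) @[n --> \oo] --> (0 : R)) ->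
  katetov_le I diffuse_ideal.
Proof.
move=> I0; exists (fun y => (decode y).2.1) => A /I0/cvgn0P A0.
apply/cvgn0P => e /A0[N AN]; exists N => m /AN.
apply: le_lt_trans; rewrite !ger0_norm ?diffuse_ge0 ?sumr_ge0//.
rewrite [leRHS]big_mkcond; apply: ler_sum => x _ /=.
have -> : \sum_(l < fiber_size m | (m, (x : nat, l : nat)) \in
      pickle @^-1` ((fun y => (decode y).2.1) @^-1` A)) diffuse_weight m x =
    if (x : nat) \in A then diffuse_weight m x * (fiber_size m)%:R else 0.
  have E (l : 'I_(fiber_size m)) : ((m, (x : nat, l : nat)) \in
     @pickle T @^-1` ((fun y => (decode y).2.1) @^-1` A)) = ((x : nat) \in A).
    by apply/idP/idP; rewrite !in_setE /= pickleD.
  under eq_bigl do rewrite E.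
  case: (_ \in A); last by rewrite big_pred0.
  by rewrite sumr_const card_ord mulr_natr.
case: ifP => // _.
have L0 : 0 < (fiber_size m)%:R :> R by rewrite ltr0n fiber_size_gt0.
rewrite /diffuse_weight invfM mulrA divfK ?gt_eqF// ler_pdivrMr ?total_mass_gt0//.
rewrite ler_wpM2l// (le_trans _ (h_large m))// ler_nat.
by rewrite (leq_trans _ (leqnSn _))// leq_pmulr.
Qed.

(* Cells of the partition l mod (n + 1)^2 below level n, joined with everything
   that the n-th measure sees above level n. *)
Definition test_set (F : nat -> T) n j : set T :=
  [set t | if (t.1 <= n)%N then (t.2.2 %% n.+1 ^ 2)%N = j
           else exists2 y, (y < b n)%N & F y = t].

(** Up to level [n] the set takes about 1 / (n + 1)^2 of a fibre, and m <= n; above, it has at most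
    [b n] points, few by the choice of [fiber_size]. The bound is free of [n] and [j], so test sets
    for different [n] can be glued. *)
Lemma diffuse_test_set F n j m : diffuse m (test_set F n j) <= 2 / m.+1%:R.
Proof.
have mL : (m.+1 ^ 2 <= fiber_size m)%N by rewrite leq_pmulr.
have [mn|nm] := leqP m n.
  apply: (@diffuse_le _ _ (fiber_size m %/ n.+1 ^ 2).+1) => [x|].
    rewrite (leq_trans _ (@card_ord_modn _ _ j _)) ?expn_gt0//.
    apply/subset_leq_card/fintype.subsetP => l.
    by move=> /set_mem; rewrite /test_set /= mn inE => ->.
  (* With p = (n + 1)^2 and L the fibre size, (L / p + 1)(m + 1)^2 <= (L / p) p + L <= 2 L for the
     integer quotient L / p; hence the constant 2. *)
  have : (m.+1 ^ 2 <= n.+1 ^ 2)%N by rewrite leq_exp2r.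
  have := leq_divM (fiber_size m) (n.+1 ^ 2).
  by nia.
apply: (@diffuse_le _ _ (b n)) => [x|].
  apply: (@card_ord_image _ _ _ (fun y => (F y).2.2)) => l.
  move=> /set_mem; rewrite /test_set /= leqNgt nm => -[y yb Fy].
  by exists y => //; rewrite Fy.
rewrite mulnC /fiber_size mulnCA leq_mul// (bigD1 (Ordinal nm)) //=; lia.
Qed.

(** Outside the head, mass at least [n.+1 ^ 2] remains, and each of its points is sent into at least
    one of the [n.+1 ^ 2] test sets: the one of its residue up to level [n], all of them above. By
    pigeonhole one test set receives mass 1. *)
Lemma test_set_heavy (F : nat -> T) N n :
  \sum_(x < b n | ((F x).1 < N)%N) rho n x <= 1 ->
  exists j, 1 <= \sum_(x < b n | (F x \in test_set F n j) && (N <= (F x).1)%N)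
    rho n x.
Proof.
move=> headN; apply: contrapT => noj.
have : \sum_(j < n.+1 ^ 2) \sum_(x < b n | (F x \in test_set F n j)
    && (N <= (F x).1)%N) rho n x < \sum_(j < n.+1 ^ 2) 1.
  apply: ltr_sum => [|j _].
    have n0 : (0 < n.+1 ^ 2)%N by rewrite expn_gt0.
    by apply/hasP; exists (Ordinal n0); rewrite ?mem_index_enum.
  by rewrite ltNge; apply/negP => ?; apply: noj; exists j.
apply/negP; rewrite -leNgt sumr_const card_ord.
under eq_bigr do rewrite big_mkcond.
rewrite exchange_big /=.
have : ((n.+1 ^ 2).+1)%:R <= 1 + \sum_(x < b n | (N <= (F x).1)%N) rho n x.
  apply: le_trans (h_large n) _; rewrite /h.
  rewrite (bigID (fun x : 'I__ => ((F x).1 < N)%N)) /=.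
  by under [X in _ + X <= _]eq_bigl do rewrite -leqNgt; rewrite lerD2r.
rewrite -addn1 natrD addrC lerD2l => /le_trans; apply.
rewrite big_mkcond; apply: ler_sum => x _; case: ifP => NF; last first.
  by rewrite big1// => j _; rewrite andbF.
have p0 : ((F x).2.2 %% n.+1 ^ 2 < n.+1 ^ 2)%N by rewrite ltn_mod expn_gt0.
rewrite (bigD1 (Ordinal p0)) //= andbT mem_set /=; last first.
  by rewrite /test_set /=; case: ifP => // _; exists x.
by rewrite lerDl sumr_ge0// => j _; case: ifP.
Qed.

Lemma diffuse_ideal_not_le (I : ideal) :
  (forall A, I A ->
    (\sum_(x < b n | (x : nat) \in A) rho n x) @[n --> \oo] --> (0 : R)) ->
  ~ katetov_le diffuse_ideal I.
Proof.
move=> I0 [f fI]; pose F x := decode (f x).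
have F0 (A : set T) : diffuse_sets A ->
    (\sum_(x < b n | F x \in A) rho n x) @[n --> \oo] --> (0 : R).
  move=> A0; apply: (I0 (F @^-1` A)); apply: (fI (decode @^-1` A)).
  rewrite /diffuse_ideal /= (_ : _ @^-1` _ = A) //.
  by apply/funext => t /=; rewrite pickleD.
have [N|U [a [a0 aS aU]]] := @gliding_hump T fst
  (fun N M A => exists2 n, (N <= n)%N &
     1 <= \sum_(x < b n | (F x \in A) && (N <= (F x).1 < M)%N) rho n x /\
     forall m, diffuse m A <= 2 / m.+1%:R).
  (* The levels below [N] form a set of the diffuse ideal, so the assumed reduction leaves them mass
     below 1 for large [n]; the heavy part can then be sought from level [N] on. *)
  have [K headK] := proj1 (cvgn0P _) (F0 _ (diffuse_sets_bounded N)) 1 ltr01.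
  have := headK _ (leq_maxr N K); set n := maxn N K.
  rewrite ger0_norm ?sumr_ge0// => /ltW head1.
  have [|j jheavy] := @test_set_heavy F N n.
    rewrite (eq_bigl (fun x : 'I__ => F x \in [set t | (t.1 < N)%N])) // => x.
    by apply/idP/idP; rewrite in_setE.
  (* This exceeds every level that [F] reaches on the support, so cutting the block off here loses
     no mass. *)
  exists (maxn N (\max_(x < b n) (F x).1)).+1, (test_set F n j).
  split; first by rewrite ltnS leq_maxl.
  exists n; first exact: leq_maxl.
  split=> [|m]; last exact: diffuse_test_set.
  rewrite (eq_bigl (fun x : 'I__ =>
    (F x \in test_set F n j) && (N <= (F x).1)%N)) // => x.
  rewrite ltnS [X in _ && (_ && X)](_ : _ = true) ?andbT//.
  by rewrite leq_max (@leq_bigmax _ (fun x : 'I_(b n) => (F x).1) x) orbT.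
have /F0/cvgn0P/(_ 1 ltr01)[K UK] : diffuse_sets U.
  (* On level [m], [U] coincides with the set chosen for one block, and the bound [2 / m.+1] is the
     same for every block. *)
  apply/cvgn0P => e e0; exists (Num.trunc (2 / e)) => m em.
  have [i im] := increasing_block _ a0 aS m.
  have [A [[n _ [_ Am]] UA]] := aU i.
  rewrite (@eq_diffuse m U A) ?ger0_norm ?diffuse_ge0//; last first.
    by move=> t tm; apply: UA; rewrite tm.
  apply: le_lt_trans (Am m) _; rewrite ltr_pdivrMr// mulrC -ltr_pdivrMr//.
  by apply: lt_le_trans (truncnS_gt _) _; rewrite ler_nat.
have [A [[n an [A1 _]] UA]] := aU K.
have := UK n (leq_trans (increasing_ge_id _ aS K) an).
rewrite ger0_norm ?sumr_ge0//; apply/negP; rewrite -leNgt (le_trans A1)//.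
rewrite [leLHS]big_mkcond [leRHS]big_mkcond; apply: ler_sum => x _ /=.
case: ifPn => [/andP[FA Fa]|_]; last by case: ifP.
by rewrite mem_set //; apply/UA => //; exact: set_mem.
Qed.

End diffuse.

(** * Nonnegative, fast growing weights, and the conclusion *)

(** Subsets of a set in [I] are in [I], so Schur's theorem applies on each such set and permits
    absolute values. Thinning by [s] with [n <= s n] keeps these limits and gives the growth. *)
Lemma AN_nonneg_weights (I : ideal) : AN R I ->
  exists (rho : nat -> nat -> R) (b : nat -> nat),
  [/\ forall n x, 0 <= rho n x,
      forall n, ((n.+1 ^ 2).+1)%:R <= \sum_(x < b n) rho n x
    & forall A, I A ->
        (\sum_(x < b n | (x : nat) \in A) rho n x) @[n --> \oo] --> (0 : R)].
Proof.
move=> /AN_weights[nu [b [nuy nu0]]].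
have /choice[s sP] : forall n, exists k, (n <= k)%N /\
    ((n.+1 ^ 2).+1)%:R <= \sum_(x < b k) `|nu k x|.
  move=> n; have [N nuN] := proj1 (cvgnyP _) nuy ((n.+1 ^ 2).+1)%:R.
  by exists (maxn n N); rewrite leq_maxl nuN ?leq_maxr.
exists (fun n x => `|nu (s n) x|), (b \o s); split=> [//|n|A IA].
  by have [] := sP n.
apply/cvgn0P => e e0; have [|N NA] := proj1 (cvgn0P _) (schur_l1 nu b A _) e e0.
  by move=> B BA; apply: nu0; exact: ideal_subset BA IA.
by exists N => n Nn; apply: NA; apply: leq_trans Nn _; have [] := sP n.
Qed.

End proof.

Theorem mainTheorem6 (R : realType) (I : ideal) (hI : AN R I) :
  exists J : ideal, AN R J /\ katetov_lt I J.
Proof.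
have [rho [b [rho_ge0 h_large I0]]] := AN_nonneg_weights _ hI.
exists (diffuse_ideal _ _ rho_ge0 h_large); split; first exact: diffuse_ideal_AN.
by split; [exact: le_diffuse_ideal|exact: diffuse_ideal_not_le].
Qed.
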